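(* Let $G$ be a nonempty finite boundary-interior bipartite $\partial$-graph such that $|V^\circ|\ge|\partial V|$ and every interior vertex has degree at least $2$. Then $G$ is not completely reducible.
   Context: Graphs are undirected multigraphs with vertex set $V$ and set $E$ of oriented edges (each undirected edge gives $e$ and its reverse $\overline{e}$); $e_+$, $e_-$ are the starting and ending vertices of $e$; the degree of $x$ is the number of $e\in E$ with $e_+=x$. A $\partial$-graph is a graph with a partition $V=V^\circ\sqcup\partial V$ (interior and boundary vertices). It is boundary-interior bipartite if every edge has one interior endpoint and one boundary endpoint. Simple layerable extensions: $G'$ is obtained from $G$ by (i) adjoining an isolated boundary vertex $x$ if $V(G')=V(G)\sqcup\{x\}$, $E(G')=E(G)$, $V^\circ(G')=V^\circ(G)$, and $x$ is a boundary vertex of $G'$ with no incident edges; (ii) adjoining a boundary spike $e$ if $V(G')=V(G)\sqcup\{e_+\}$, $E(G')=E(G)\sqcup\{e,\overline{e}\}$, $V^\circ(G')=V^\circ(G)\sqcup\{e_-\}$, where in $G'$ the vertex $e_-$ is interior and $e_+$ is a boundary vertex with no other incident edges (so $e_-\in\partial V(G)$); (iii) adjoining a boundary edge $e$ if $V(G')=V(G)$, $V^\circ(G')=V^\circ(G)$, $E(G')=E(G)\sqcup\{e,\overline{e}\}$ and both endpoints of $e$ are boundary vertices. Given $\partial$-graphs $G_1,G_2$ and $x_i\in\partial V(G_i)$, the boundary wedge-sum $G_1\vee G_2$ is obtained from $G_1\sqcup G_2$ by identifying $x_1$ with $x_2$ (the common vertex being a boundary vertex). Completely reducible finite $\partial$-graphs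 form the smallest class of finite $\partial$-graphs that contains the empty graph and is closed under layerable extensions (finite sequences of simple layerable extensions), disjoint unions, and boundary wedge-sums. *)

(* Defs.v *)
From mathcomp Require Import all_boot.

Set Implicit Arguments.
Unset Strict Implicit.
Unset Printing Implicit Defensive.

(* Edges are oriented: an undirected edge is a pair {e, rev e} with
   rev e != e, self-loops included. [start e] is e_+ and [stop e] is e_-. *)
Record bgraph := BGraph {
  vertex : finType;
  edge : finType;
  start : edge -> vertex;
  stop : edge -> vertex;
  rev : edge -> edge;
  revK : involutive rev;
  rev_neq : forall e, rev e != e;
  start_rev : forall e, start (rev e) = stop e;
  interior : {set vertex}
}.

Definition boundary (G : bgraph) : {set vertex G} := ~: interior G.

Definition degree (G : bgraph) (x : vertex G) : nat :=
  #|[set e : edge G | start e == x]|.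

Definition boundary_interior_bipartite (G : bgraph) : Prop :=
  forall e : edge G,
    (start e \in interior G /\ stop e \in boundary G) \/
    (start e \in boundary G /\ stop e \in interior G).

(* An isomorphism of G onto a subgraph of H. It ignores the partition into
   interior and boundary vertices, which each operation below treats
   differently. All the operations are stated through embeddings, hence up to
   isomorphism. *)
Record embedding (G H : bgraph) := Embedding {
  emb_v : vertex G -> vertex H;
  emb_e : edge G -> edge H;
  emb_v_inj : injective emb_v;
  emb_e_inj : injective emb_e;
  emb_start : forall e, start (emb_e e) = emb_v (start e);
  emb_stop : forall e, stop (emb_e e) = emb_v (stop e);
  emb_rev : forall e, rev (emb_e e) = emb_e (rev e)
}.

Definition adjoins_isolated_boundary_vertex (G G' : bgraph) : Prop :=
  exists (f : embedding G G') (x : vertex G'),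
    [/\ codom (emb_v f) =i predC1 x,
        codom (emb_e f) =i predT,
        interior G' = emb_v f @: interior G,
        x \in boundary G' &
        forall a : edge G', start a != x].

Definition adjoins_boundary_spike (G G' : bgraph) : Prop :=
  exists (f : embedding G G') (e : edge G'),
    [/\ codom (emb_v f) =i predC1 (start e),
        codom (emb_e f) =i predC (pred2 e (rev e)),
        stop e \in emb_v f @: boundary G,
        interior G' = stop e |: emb_v f @: interior G &
        start e \in boundary G' /\
        (forall a : edge G', start a = start e -> a = e)].

Definition adjoins_boundary_edge (G G' : bgraph) : Prop :=
  exists (f : embedding G G') (e : edge G'),
    [/\ codom (emb_v f) =i predT,
        codom (emb_e f) =i predC (pred2 e (rev e)),
        interior G' = emb_v f @: interior G,
        start e \in boundary G' &
        stop e \in boundary G'].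

Definition simple_layerable_extension (G G' : bgraph) : Prop :=
  [\/ adjoins_isolated_boundary_vertex G G',
      adjoins_boundary_spike G G' |
      adjoins_boundary_edge G G'].

Inductive layerable_extension (G : bgraph) : bgraph -> Prop :=
| layerable_refl : layerable_extension G G
| layerable_step (H K : bgraph) :
    layerable_extension G H -> simple_layerable_extension H K ->
    layerable_extension G K.

Definition is_disjoint_union (G1 G2 G : bgraph) : Prop :=
  exists (f1 : embedding G1 G) (f2 : embedding G2 G),
    [/\ codom (emb_v f2) =i [predC codom (emb_v f1)],
        codom (emb_e f2) =i [predC codom (emb_e f1)] &
        interior G = emb_v f1 @: interior G1 :|: emb_v f2 @: interior G2].

(* The images of G1 and G2 cover the vertices of G and meet exactly in the
   common image of x1 and x2. *)
Definition is_boundary_wedge_sum (G1 G2 : bgraph)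
    (x1 : vertex G1) (x2 : vertex G2) (G : bgraph) : Prop :=
  [/\ x1 \in boundary G1, x2 \in boundary G2 &
  exists (f1 : embedding G1 G) (f2 : embedding G2 G),
    [/\ emb_v f1 x1 = emb_v f2 x2,
        forall v1 v2, emb_v f1 v1 = emb_v f2 v2 -> v1 = x1 /\ v2 = x2,
        forall v, (v \in codom (emb_v f1)) || (v \in codom (emb_v f2)),
        codom (emb_e f2) =i [predC codom (emb_e f1)] &
        interior G = emb_v f1 @: interior G1 :|: emb_v f2 @: interior G2]].

Inductive completely_reducible : bgraph -> Prop :=
| cr_empty (G : bgraph) :
    #|vertex G| = 0 -> completely_reducible G
| cr_layerable_extension (G G' : bgraph) :
    completely_reducible G -> layerable_extension G G' ->
    completely_reducible G'
| cr_disjoint_union (G1 G2 G : bgraph) :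
    completely_reducible G1 -> completely_reducible G2 ->
    is_disjoint_union G1 G2 G -> completely_reducible G
| cr_boundary_wedge_sum (G1 G2 : bgraph)
    (x1 : vertex G1) (x2 : vertex G2) (G : bgraph) :
    completely_reducible G1 -> completely_reducible G2 ->
    is_boundary_wedge_sum x1 x2 G -> completely_reducible G.

(* Main.v *)
Require Import Defs.
From mathcomp Require Import all_boot.
From mathcomp Require Import all_order all_algebra.
Import GRing.Theory Num.Theory.

(** Call a graph rigid if, for every symmetric, nowhere zero, rational weight on
    its edges, the only function which vanishes on the boundary and whose
    weighted Laplacian vanishes at all the vertices, boundary vertices included,
    is zero. Every completely reducible graph is rigid
    ([completely_reducible_rigid]): a function on the larger graph restricts to
    the smaller ones without changing the Laplacian, because the missing edges
    carry no current. For a spike this uses that the vanishing current at the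
    new boundary vertex forces the function to vanish at the other end of the
    spike. At the vertex where a wedge-sum is glued it uses that the Laplacian
    on each summand sums to zero over all its vertices.

    On the other hand the graph of the theorem is not rigid
    ([bipartite_not_rigid]). As each interior vertex has degree at least 2, the
    weights can be chosen with zero sum around each interior vertex. A function
    that vanishes on the boundary then has zero Laplacian at every interior
    vertex, and the Laplacian at the boundary vertices is a linear map given by
    a matrix M with one row for each interior vertex and one column for each
    boundary vertex. The rows of M have zero sum, so the rank of M is less than
    the number of boundary vertices if there are any, hence less than the number
    of interior vertices, and M has a nonzero vector in its left kernel.
    (Without boundary vertices M has no columns, and the left kernel is
    everything.) *)

Set Implicit Arguments.
Unset Strict Implicit.
Unset Printing Implicit Defensive.

Local Open Scope ring_scope.

Local Notation rev := (@Defs.rev _).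

(** * Weighted Laplacians and rigidity *)

(** The current along the oriented edge [e] for the potential [u]. *)
Definition current (G : bgraph) (w : edge G -> rat) (u : vertex G -> rat)
    (e : edge G) : rat :=
  w e * (u (stop e) - u (start e)).

(** The Laplacian of [u], up to sign: the total current leaving [v]. *)
Definition laplacian (G : bgraph) (w : edge G -> rat) (u : vertex G -> rat)
    (v : vertex G) : rat :=
  \sum_(e | start e == v) current w u e.

(** The symmetric weights which vanish on no edge. *)
Definition admissible_weight (G : bgraph) (w : edge G -> rat) : Prop :=
  (forall e, w (rev e) = w e) /\ (forall e, w e != 0).

(** For every admissible weight, the only function with zero Dirichlet and zero
    Neumann boundary data that is harmonic in the interior is zero. *)
Definition rigid (G : bgraph) : Prop :=
  forall (w : edge G -> rat) (u : vertex G -> rat),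
    admissible_weight w ->
    (forall v, v \in boundary G -> u v = 0) ->
    (forall v, laplacian w u v = 0) ->
    forall v, u v = 0.

Lemma stop_rev (G : bgraph) (e : edge G) : stop (rev e) = start e.
Proof. by rewrite -start_rev Defs.revK. Qed.

Lemma sum_laplacian (G : bgraph) (w : edge G -> rat) (u : vertex G -> rat) :
  (forall e, w (rev e) = w e) -> \sum_v laplacian w u v = 0.
Proof.
move=> w_rev.
have -> : \sum_v laplacian w u v = \sum_e current w u e.
  rewrite [RHS](partition_big (@start G) xpredT) //=.
(* Reversing an edge negates its current, so the sum is its own opposite. *)
have sumN : \sum_e current w u e = - \sum_e current w u e.
  rewrite {1}(reindex_inj (inv_inj (@Defs.revK G))) /= -sumrN.
  apply: eq_bigr => e _.
  by rewrite /current w_rev start_rev stop_rev -mulrN opprB.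
have /eqP : (\sum_e current w u e) *+ 2 = 0 by rewrite mulr2n {1}sumN addNr.
by rewrite mulrn_eq0 => /eqP.
Qed.

(** * Restriction along an embedding *)

Lemma admissible_weight_emb (G H : bgraph) (f : embedding G H)
    (w : edge H -> rat) :
  admissible_weight w -> admissible_weight (fun e => w (emb_e f e)).
Proof. by case=> w_rev w_neq0; split=> e //; rewrite -emb_rev w_rev. Qed.

(** Edges outside the subgraph contribute nothing as soon as they carry no
    current. *)
Lemma laplacian_emb (G H : bgraph) (f : embedding G H) (w : edge H -> rat)
    (u : vertex H -> rat) (v : vertex G) :
  (forall e, e \notin codom (emb_e f) -> start e = emb_v f v ->
    current w u e = 0) ->
  laplacian (fun e => w (emb_e f e)) (fun x => u (emb_v f x)) v =
  laplacian w u (emb_v f v).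
Proof.
move=> cur0; rewrite /laplacian [RHS](bigID (mem (codom (emb_e f)))) /=.
rewrite [X in _ + X]big1 ?addr0; last by move=> e /andP[/eqP ? ?]; exact: cur0.
rewrite (eq_bigl (fun e => (e \in emb_e f @: predT) &&
                           (start e == emb_v f v))); last first.
  move=> e; rewrite andbC; congr (_ && _).
  by apply/codomP/imsetP => [[x ->]|[x _ ->]]; exists x.
rewrite big_imset_cond /=; last by move=> ? ? _ _; exact: emb_e_inj.
apply: eq_big => [e|e _].
  by rewrite emb_start (inj_eq (@emb_v_inj _ _ f)).
by rewrite /current emb_start emb_stop.
Qed.

(** Rigidity of a subgraph passes to the larger graph on the vertices of the
    subgraph. *)
Lemma rigid_emb (G H : bgraph) (f : embedding G H) (w : edge H -> rat)
    (u : vertex H -> rat) :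
  rigid G -> admissible_weight w ->
  (forall v, v \in boundary G -> u (emb_v f v) = 0) ->
  (forall v, laplacian w u v = 0) ->
  (forall e, e \notin codom (emb_e f) -> start e \in codom (emb_v f) ->
    current w u e = 0) ->
  forall v, u (emb_v f v) = 0.
Proof.
move=> rG adm_w u0 lap0 cur0.
apply: (rG (fun e => w (emb_e f e)) (fun v => u (emb_v f v))) => // [|v].
  exact: admissible_weight_emb.
rewrite laplacian_emb ?lap0 // => e ef sev.
by apply: cur0; rewrite // sev codom_f.
Qed.

Lemma emb_boundary (G H : bgraph) (f : embedding G H) (v : vertex G) :
  interior H = emb_v f @: interior G ->
  (emb_v f v \in boundary H) = (v \in boundary G).
Proof. by move=> iH; rewrite !inE iH mem_imset //; exact: emb_v_inj. Qed.

(** * Completely reducible graphs are rigid *)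

Lemma rigid_isolated_boundary_vertex (G G' : bgraph) :
  rigid G -> adjoins_isolated_boundary_vertex G G' -> rigid G'.
Proof.
move=> rG [f [x [fv fe iG' xb _]]] w u adm_w u0 lap0 v.
have uf : forall a, u (emb_v f a) = 0.
  apply: (rigid_emb rG adm_w) => // [a ab|e]; last by rewrite fe.
  by apply: u0; rewrite emb_boundary.
have [->|] := eqVneq v x; first exact: u0.
by move=> vx; have : v \in predC1 x by []; rewrite -fv => /codomP[a ->].
Qed.

Lemma current_zero_ends (G : bgraph) (w : edge G -> rat) (u : vertex G -> rat)
    (e a : edge G) :
  u (start e) = 0 -> u (stop e) = 0 -> (a == e) || (a == rev e) ->
  current w u a = 0.
Proof.
move=> us ut /orP[]/eqP->; rewrite /current ?start_rev ?stop_rev us ut;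
by rewrite subrr mulr0.
Qed.

Lemma rigid_boundary_spike (G G' : bgraph) :
  rigid G -> adjoins_boundary_spike G G' -> rigid G'.
Proof.
move=> rG [f [e [fv fe te iG' [sb se_uniq]]]] w u adm_w u0 lap0 v.
have us : u (start e) = 0 by exact: u0.
(* The spike is the only edge at its boundary end. *)
have ut : u (stop e) = 0.
  have := lap0 (start e); rewrite /laplacian (big_pred1 e); last first.
    by move=> a; apply/eqP/eqP => [/se_uniq|->].
  rewrite /current us subr0 => /eqP; rewrite mulf_eq0.
  by rewrite (negbTE (adm_w.2 e)) => /eqP.
have uf : forall a, u (emb_v f a) = 0.
  apply: (rigid_emb rG adm_w) => // [a ab|a].
    have [->//|at_e] := eqVneq (emb_v f a) (stop e).
    apply: u0; rewrite inE iG' !inE (negbTE at_e) /=.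
    by rewrite mem_imset; [move: ab; rewrite inE | exact: emb_v_inj].
  rewrite fe inE negbK => ae _; exact: (current_zero_ends _ us ut ae).
have [->//|] := eqVneq v (start e).
by move=> vx; have : v \in predC1 (start e) by []; rewrite -fv => /codomP[a ->].
Qed.

Lemma rigid_boundary_edge (G G' : bgraph) :
  rigid G -> adjoins_boundary_edge G G' -> rigid G'.
Proof.
move=> rG [f [e [fv fe iG' sb tb]]] w u adm_w u0 lap0 v.
have uf : forall a, u (emb_v f a) = 0.
  apply: (rigid_emb rG adm_w) => // [a ab|a].
    by apply: u0; rewrite emb_boundary.
  rewrite fe inE negbK => ae _.
  exact: (current_zero_ends _ (u0 _ sb) (u0 _ tb) ae).
by have : v \in codom (emb_v f); [rewrite fv | case/codomP=> a ->].
Qed.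

Lemma rigid_layerable_extension (G G' : bgraph) :
  rigid G -> layerable_extension G G' -> rigid G'.
Proof.
move=> rG; elim=> // H K _ rH [].
- exact: rigid_isolated_boundary_vertex.
- exact: rigid_boundary_spike.
- exact: rigid_boundary_edge.
Qed.

Lemma codom_emb_start (G H : bgraph) (f : embedding G H) (e : edge H) :
  e \in codom (emb_e f) -> start e \in codom (emb_v f).
Proof. by case/codomP=> a ->; rewrite emb_start codom_f. Qed.

Lemma rigid_disjoint_union (G1 G2 G : bgraph) :
  rigid G1 -> rigid G2 -> is_disjoint_union G1 G2 G -> rigid G.
Proof.
move=> r1 r2 [f1 [f2 [fv fe iG]]] w u adm_w u0 lap0 v.
have sep a1 a2 : emb_v f1 a1 <> emb_v f2 a2.
  move=> eq12; have := codom_f (emb_v f2) a2.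
  by rewrite fv -eq12 inE codom_f.
have uf1 : forall a, u (emb_v f1 a) = 0.
  apply: (rigid_emb r1 adm_w) => // [a ab|e e1 s1].
    apply: u0; rewrite inE iG inE negb_or mem_imset; last exact: emb_v_inj.
    move: ab; rewrite inE => -> /=.
    by apply/imsetP=> -[b _ /sep].
  have /codom_emb_start : e \in codom (emb_e f2) by rewrite fe.
  by rewrite fv inE s1.
have uf2 : forall a, u (emb_v f2 a) = 0.
  apply: (rigid_emb r2 adm_w) => // [a ab|e].
    apply: u0; rewrite inE iG inE negb_or andbC.
    rewrite mem_imset; last exact: emb_v_inj.
    move: ab; rewrite inE => -> /=.
    by apply/imsetP=> -[b _ /esym/sep].
  by rewrite fe inE negbK fv inE => /codom_emb_start ->.
have [/codomP[a ->]//|v1] := boolP (v \in codom (emb_v f1)).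
by have : v \in codom (emb_v f2); [rewrite fv | case/codomP=> a ->].
Qed.

(** One summand of a wedge-sum; the statement is symmetric in the two
    summands. At the vertices of [G1] other than [x1] no edge of [G2] starts,
    so the Laplacian on [G1] vanishes there; it vanishes at [x1] too, as it
    sums to zero. *)
Lemma rigid_wedge_summand (G1 G2 G : bgraph) (x1 : vertex G1) (x2 : vertex G2)
    (f1 : embedding G1 G) (f2 : embedding G2 G)
    (w : edge G -> rat) (u : vertex G -> rat) :
  rigid G1 -> x2 \in boundary G2 ->
  (forall v1 v2, emb_v f1 v1 = emb_v f2 v2 -> v1 = x1 /\ v2 = x2) ->
  (forall e, e \notin codom (emb_e f1) -> e \in codom (emb_e f2)) ->
  interior G = emb_v f1 @: interior G1 :|: emb_v f2 @: interior G2 ->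
  admissible_weight w ->
  (forall v, v \in boundary G -> u v = 0) ->
  (forall v, laplacian w u v = 0) ->
  forall v, u (emb_v f1 v) = 0.
Proof.
move=> r1 x2b sep fe iG adm_w u0 lap0.
have adm_w1 := admissible_weight_emb f1 adm_w.
apply: (r1 _ (fun v => u (emb_v f1 v)) adm_w1) => [v vb|].
  apply: u0; rewrite inE iG inE negb_or mem_imset; last exact: emb_v_inj.
  move: vb; rewrite inE => -> /=.
  apply/imsetP=> -[b bi /sep[_ b2]].
  by move: x2b; rewrite inE -b2 bi.
set L := laplacian _ _.
have L0 v : v != x1 -> L v = 0.
  move=> vx1; rewrite /L laplacian_emb // => e /fe/codom_emb_start/codomP[b ->].
  by case/esym/sep=> vx _; rewrite vx eqxx in vx1.
move=> v; have [->|/L0//] := eqVneq v x1.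
have := sum_laplacian (fun v => u (emb_v f1 v)) adm_w1.1.
by rewrite (bigD1 x1) //= big1 ?addr0 // => b /L0.
Qed.

Lemma rigid_boundary_wedge_sum (G1 G2 : bgraph) (x1 : vertex G1)
    (x2 : vertex G2) (G : bgraph) :
  rigid G1 -> rigid G2 -> is_boundary_wedge_sum x1 x2 G -> rigid G.
Proof.
move=> r1 r2 [x1b x2b [f1 [f2 [_ sep cover fe iG]]]] w u adm_w u0 lap0 v.
have uf1 : forall a, u (emb_v f1 a) = 0.
  apply: (rigid_wedge_summand r1 x2b sep _ iG adm_w u0 lap0) => e.
  by rewrite fe.
have uf2 : forall a, u (emb_v f2 a) = 0.
  have sep' a2 a1 : emb_v f2 a2 = emb_v f1 a1 -> a2 = x2 /\ a1 = x1.
    by move=> /esym/sep[].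
  rewrite setUC in iG.
  apply: (rigid_wedge_summand r2 x1b sep' _ iG adm_w u0 lap0) => e.
  by rewrite fe inE negbK.
by have /orP[] := cover v => /codomP[a ->].
Qed.

Lemma completely_reducible_rigid (G : bgraph) :
  completely_reducible G -> rigid G.
Proof.
elim=> {G}.
- by move=> G /card0_eq G0 w u _ _ _ v; have := G0 v; rewrite !inE.
- by move=> G G' _ rG; exact: rigid_layerable_extension.
- by move=> G1 G2 G _ r1 _ r2; exact: rigid_disjoint_union.
- by move=> G1 G2 x1 x2 G _ r1 _ r2; exact: rigid_boundary_wedge_sum.
Qed.

(** * Bipartite graphs with many interior vertices are not rigid *)

Lemma stop_boundary (G : bgraph) (e : edge G) :
  boundary_interior_bipartite G ->
  start e \in interior G -> stop e \in boundary G.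
Proof. by move=> /(_ e); rewrite !inE => -[][] // /negbTE->. Qed.

Lemma stop_interior (G : bgraph) (e : edge G) :
  boundary_interior_bipartite G ->
  start e \in boundary G -> stop e \in interior G.
Proof. by move=> /(_ e); rewrite !inE => -[][] // ->. Qed.

(** Around each interior vertex all the weights are 1, except for one edge
    which compensates for the others. *)
Lemma exists_balanced_weight (G : bgraph) :
  boundary_interior_bipartite G ->
  (forall x : vertex G, x \in interior G -> (2 <= degree x)%N) ->
  exists2 w : edge G -> rat, admissible_weight w &
    forall v, v \in interior G -> \sum_(e | start e == v) w e = 0.
Proof.
move=> G_bipartite G_degree.
pose special (e : edge G) := [pick a | start a == start e] == Some e.
pose w0 (e : edge G) : rat :=
  if special e then - (degree (start e)).-1%:R else 1.
pose w (e : edge G) := w0 (if start e \in interior G then e else rev e).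
exists w.
  split=> e; rewrite /w.
    rewrite start_rev Defs.revK.
    have [si|sb] := boolP (start e \in interior G).
      by have := stop_boundary G_bipartite si; rewrite inE => /negbTE->.
    by rewrite (stop_interior G_bipartite) ?inE ?sb.
  set a := if _ then _ else _.
  have /G_degree da : start a \in interior G.
    rewrite /a; case: ifPn => // se; rewrite start_rev.
    by apply: (stop_interior G_bipartite); rewrite inE.
  rewrite /w0; case: ifP => _; last exact: oner_neq0.
  by rewrite oppr_eq0 pnatr_eq0 -lt0n; case: (degree _) da => [|[]].
move=> v vi.
rewrite (eq_bigr w0) => [|e /eqP se]; last by rewrite /w se vi.
have : (0 < degree v)%N by apply: ltnW; exact: G_degree.
rewrite /degree card_gt0 => /set0Pn[a0]; rewrite inE => a0v.
have [a av aE] : exists2 a, start a == v & [pick a | start a == v] = Some a.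
  by case: pickP => [a av|/(_ a0)]; [exists a | rewrite a0v].
rewrite (bigD1 a) //= (eq_bigr (fun=> 1)) => [|e /andP[/eqP se ea]].
  rewrite /w0 /special (eqP av) aE eqxx sumr_const.
  rewrite /degree (cardsD1 a) inE av /=.
  rewrite [X in - X%:R + _](_ : _ = #|[set e | start e == v] :\ a|) //.
  rewrite (_ : #|_| = #|[pred e | start e == v & e != a]|) ?addNr //.
  by apply: eq_card => e; rewrite !inE andbC.
by rewrite /w0 /special se aE; case: eqP => // -[ae]; rewrite ae eqxx in ea.
Qed.

Lemma bipartite_not_rigid (G : bgraph) :
  boundary_interior_bipartite G ->
  (0 < #|vertex G|)%N -> (#|boundary G| <= #|interior G|)%N ->
  (forall x : vertex G, x \in interior G -> (2 <= degree x)%N) ->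
  ~ rigid G.
Proof.
move=> G_bipartite G_nonempty G_card.
case/(exists_balanced_weight G_bipartite)=> w adm_w w_bal rG.
have [w_rev _] := adm_w.
pose M : 'M[rat]_(#|interior G|, #|boundary G|) := \matrix_(i, j)
  \sum_(e | (start e == enum_val i) && (stop e == enum_val j)) w e.
have M1 : M *m const_mx 1 = 0 :> 'cV_#|interior G|.
  apply/colP => i; rewrite !mxE.
  rewrite -[RHS](w_bal (enum_val i)); last exact: enum_valP.
  rewrite [RHS](partition_big (@stop G) (mem (boundary G))) /=; last first.
    by move=> e /eqP se; rewrite stop_boundary // se enum_valP.
  rewrite [RHS]big_enum_val.
  by apply: eq_bigr => j _; rewrite !mxE mulr1.
have rankM : (\rank M < #|interior G|)%N.
  have [B0|B_gt0] := posnP #|boundary G|.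
    rewrite (leq_ltn_trans (rank_leq_col M)) // B0.
    by move: G_nonempty; rewrite -(cardsC (interior G)) -/(boundary G) B0 addn0.
  (* By M1 the columns of M are dependent. *)
  apply: leq_trans G_card; rewrite ltn_neqAle rank_leq_col andbT.
  apply/negP => /row_fullP[N NM]; have := congr1 (mulmx N) M1.
  rewrite mulmxA NM mul1mx mulmx0 => /colP/(_ (Ordinal B_gt0)).
  by rewrite !mxE => /eqP; rewrite oner_eq0.
have [x x0 xM] : exists2 x : 'rV_#|interior G|, x != 0 & x *m M = 0.
  have : kermx M != 0 by rewrite kermx_eq0 /row_free neq_ltn rankM.
  by case/rowV0Pn=> x /sub_kermxP xM x0; exists x.
(* The function equal to x on the interior and to 0 on the boundary. *)
pose u v := \sum_i x 0 i * (enum_val i == v)%:R.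
have uE i : u (enum_val i) = x 0 i.
  rewrite /u (bigD1 i) //= eqxx mulr1 big1 ?addr0 // => j ji.
  by rewrite (inj_eq enum_val_inj) (negbTE ji) mulr0.
have ub v : v \in boundary G -> u v = 0.
  rewrite inE => vi; rewrite /u big1 // => i _.
  by case: eqP => [iv|_]; [rewrite -iv enum_valP in vi | rewrite mulr0].
have u0 : forall v, u v = 0.
  apply: (rG w u adm_w ub) => v; rewrite /laplacian.
  have [vi|vb] := boolP (v \in interior G).
    rewrite (eq_bigr (fun e => w e * - u v)) => [|e /eqP se].
      by rewrite -mulr_suml w_bal // mul0r.
    by rewrite /current se ub ?sub0r // stop_boundary // se.
  have {}vb : v \in boundary G by rewrite inE.
  have [j jv] : exists j : 'I_#|boundary G|, v = enum_val j.
    by exists (enum_rank_in vb v); rewrite enum_rankK_in.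
  (* The Laplacian at a boundary vertex is an entry of x *m M. *)
  transitivity ((x *m M) 0 j); last by rewrite xM mxE.
  rewrite mxE (eq_bigr (fun e => \sum_i x 0 i *
                (w e * (enum_val i == stop e)%:R))) => [|e /eqP se].
    rewrite exchange_big; apply: eq_bigr => i _.
    rewrite -mulr_sumr mxE; congr (_ * _).
    rewrite [RHS](reindex_inj (inv_inj (@Defs.revK G))) /=.
    rewrite [RHS]big_mkcond [LHS]big_mkcond /=.
    apply: eq_bigr => e _.
    rewrite start_rev stop_rev w_rev -jv andbC [stop e == _]eq_sym.
    by do 2?case: eqP => _ //=; rewrite ?mulr1 ?mulr0.
  rewrite /current se (ub v) // subr0 /u mulr_sumr.
  by apply: eq_bigr => i _; rewrite mulrCA.
by case/eqP: x0; apply/rowP => i; rewrite -uE u0 mxE.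
Qed.

Local Close Scope ring_scope.

Theorem proposition7p14 (G : bgraph)
    (G_nonempty : 0 < #|vertex G|)
    (G_bipartite : boundary_interior_bipartite G)
    (G_card : #|boundary G| <= #|interior G|)
    (G_degree : forall x : vertex G, x \in interior G -> 2 <= degree x) :
  ~ completely_reducible G.
Proof.
move/completely_reducible_rigid.
exact: bipartite_not_rigid.
Qed.
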